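(* Let $\delta_i\in\Delta(n_i)$ for $i=1,2$, and put $m_i=\delta_i^{-1}(n_i)$. Let $\widehat{\delta}_i\in\Delta_\star$ be the shape of the cycle of $\delta_i$ containing $n_i$ (equivalently, containing $m_i$). Then: (i) if either $\mathcal{A}_>(\delta_1)\cap\mathcal{A}_>(\delta_2)$ or $\mathcal{G}_<(\delta_1)\cap\mathcal{G}_<(\delta_2)$ is nonempty, then there are no unimodal sums of the form $\delta_1\oplus\delta_2$; (ii) if instead (i.e. both intersections in (i) are empty and) $\widehat{\delta}_1\in\mathcal{G}_<(\delta_2)$ or $\widehat{\delta}_2\in\mathcal{A}_>(\delta_1)$, then there is no unimodal sum $\delta_1\oplus\delta_2$ with $m_1\prec m_2$; (iii) otherwise, there is exactly one unimodal sum $\delta_1\oplus\delta_2$ with $m_1\prec m_2$ (that is, exactly one permutation of this form).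
   Context: Let $I_n=\{1,\ldots,n\}$. A permutation $\delta$ of $I_n$ is unimodal if there is $m\in I_n$ such that $a<b\le m$ implies $\delta(a)<\delta(b)$, and $m\le a<b$ implies $\delta(a)>\delta(b)$. Write $\Delta(n)$ for the set of unimodal permutations of $I_n$, $\Delta_n\subset\Delta(n)$ for those consisting of a single $n$-cycle, and $\Delta_\star=\bigcup_n\Delta_n$. For a finite $J\subset\mathbb{R}$ with $k$ elements, $\Omega_J:I_k\to J$ is the increasing bijection. If $J\subseteq I_n$ is the underlying set of a cycle of $\delta\in\Delta(n)$ (fixed points are cycles of length 1), the shape of $\delta|_J$ is $\Omega_J^{-1}\circ\delta\circ\Omega_J\in\Delta_{\|J\|}$. Sums: for $\delta_1\in\Delta(k)$, $\delta_2\in\Delta(\ell)$ and $J\subset I_{k+\ell}$ with $\|J\|=k$, let $\Omega=\Omega_J$ and let $\overline{\Omega}:I_\ell\to I_{k+\ell}\setminus J$ be the increasing bijection. The sum $\delta_1\oplus_J\delta_2$ (also written $\delta_1\oplus\delta_2$) is the permutation of $I_{k+\ell}$ equal to $\Omega\circ\delta_1\circ\Omega^{-1}$ on $J$ and to $\overline{\Omega}\circ\delta_2\circ\overline{\Omega}^{-1}$ on $I_{k+\ell}\setminus J$. It is a unimodal sum if it lies in $\Delta(k+\ell)$. It is a sum with $m_1\prec m_2$ if $\Omega(m_1)<\overline{\Omega}(m_2)$, where $m_1=\delta_1^{-1}(k)$, $m_2=\delta_2^{-1}(\ell)$. Sums are considered as permutations (different $J$ giving the same permutation give the same sum). Acute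 and grave: $\delta'\in\Delta_k$ is acute if $k\equiv\delta'^{-1}(k)\pmod 2$, and grave otherwise. For $\delta\in\Delta(n)$ write $m(\delta)=\delta^{-1}(n)$, and for the underlying set $J$ of a cycle of $\delta$ let $m(\delta|_J)$ be the element of $J$ at which $\delta|_J$ takes its maximum value $\max J$. Then $\mathcal{A}_>(\delta)$ (resp. $\mathcal{G}_>(\delta)$) is the set of acute (resp. grave) $\delta'\in\Delta_\star$ that are the shape of some cycle $\delta|_J$ of $\delta$ with $m(\delta|_J)>m(\delta)$; $\mathcal{A}_<(\delta)$ and $\mathcal{G}_<(\delta)$ are defined in the same way with $m(\delta|_J)<m(\delta)$. *)

(* Defs.v *)
(* Positions and values are numbered from 0: the element i of
   {1, ..., n} is the ordinal of 'I_n with value i - 1. *)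
From mathcomp Require Import all_boot all_fingroup.
Set Implicit Arguments.
Unset Strict Implicit.
Unset Printing Implicit Defensive.

Definition unimodal (n : nat) (d : 'S_n) : bool :=
  [exists m : 'I_n, [forall a : 'I_n, forall b : 'I_n,
     ((a < b <= m) ==> (d a < d b)) && ((m <= a < b) ==> (d b < d a))]].

(* A permutation of unspecified degree; two of them are equal iff they have the
   same degree and are the same permutation. *)
Definition anyperm : Type := {k : nat & 'S_k}.

Definition Delta_star (s : anyperm) : bool :=
  unimodal (tagged s) && (#|porbits (tagged s)| == 1).

(* The parity of the degree k is compared with the 1-based position i.+1 of the
   maximal value. *)
Definition acute (s : anyperm) : bool :=
  [exists i : 'I_(tag s),
     (tagged s i == (tag s).-1 :> nat) && (tag s == i.+1 %[mod 2])].

(* Only meaningful for degree k > 0, which holds on Delta_star. *)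
Definition grave (s : anyperm) : bool := ~~ acute s.

Section Omega.
Variables (n k : nat) (J : {set 'I_n}) (hJ : #|J| = k).

(* The increasing bijection from 'I_k onto J, and its inverse. *)
Definition Omega (i : 'I_k) : 'I_n := enum_val (cast_ord (esym hJ) i).

Definition Omega_inv (x : 'I_n) (xJ : x \in J) : 'I_k :=
  cast_ord hJ (enum_rank_in xJ x).

Lemma mem_Omega i : Omega i \in J.
Proof. exact: enum_valP. Qed.

Lemma Omega_invK x (xJ : x \in J) : Omega (Omega_inv xJ) = x.
Proof. by rewrite /Omega cast_ordK enum_rankK_in. Qed.

Lemma OmegaK i (iJ : Omega i \in J) : Omega_inv iJ = i.
Proof. by rewrite /Omega_inv enum_valK_in cast_ordKV. Qed.

Lemma Omega_inj : injective Omega.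
Proof. by move=> i j /enum_val_inj/cast_ord_inj. Qed.

Lemma ltn_Omega (i j : 'I_k) : (Omega i < Omega j) = (i < j).
Proof.
have incr (a b : 'I_k) : a < b -> Omega a < Omega b.
  move=> ab; have tr : transitive (relpre (@nat_of_ord n) ltn).
    by move=> y x z; apply: ltn_trans.
  have st : sorted (relpre (@nat_of_ord n) ltn) (enum J).
    rewrite {1}/enum_mem; apply: (sorted_filter tr).
    by rewrite -sorted_map -enumT val_enum_ord iota_ltn_sorted.
  have sz (c : 'I_k) : c < size (enum J) by rewrite -cardE hJ.
  rewrite /Omega !(enum_val_nth (Omega a)) /=.
  by apply: (sorted_ltn_nth tr (Omega a) st) => //; rewrite inE sz.
apply/idP/idP; last exact: incr.
by apply: contraTT; rewrite -!leqNgt leq_eqVlt => /predU1P[/val_inj->|/incr/ltnW].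
Qed.

End Omega.

Section CycleShape.
Variables (n : nat) (d : 'S_n) (x : 'I_n).
Local Notation J := (porbit d x).

Lemma perm_porbit (y : 'I_n) : y \in J -> d y \in J.
Proof. by rewrite -!eq_porbit_mem => /eqP<-; rewrite eq_porbit_mem (mem_porbit d 1). Qed.

Definition cshape_fun (i : 'I_#|J|) : 'I_#|J| :=
  Omega_inv erefl (perm_porbit (mem_Omega erefl i)).

Lemma cshape_fun_inj : injective cshape_fun.
Proof.
move=> i j /(congr1 (Omega (erefl #|J|))).
by rewrite !Omega_invK => /perm_inj/Omega_inj.
Qed.

(* The shape of the restriction of d to the cycle J containing x. *)
Definition cycle_shape : anyperm := Tagged (fun k => 'S_k) (perm cshape_fun_inj).

(* m(d|_J): the element of J at which d takes its largest value. *)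
Definition cycle_peak : 'I_n := [arg max_(y > x in J) (d y : nat)].

End CycleShape.

(* m(d); unimodal permutations have positive degree. *)
Definition peak (n : nat) (d : 'S_n.+1) : 'I_n.+1 := (d^-1)%g ord_max.

Section ShapeSets.
Variables (n : nat) (d : 'S_n.+1).

Definition A_gt : pred anyperm := [pred s | Delta_star s && acute s &&
  [exists x, (s == cycle_shape d x) && (peak d < cycle_peak d x)]].

Definition G_gt : pred anyperm := [pred s | Delta_star s && grave s &&
  [exists x, (s == cycle_shape d x) && (peak d < cycle_peak d x)]].

Definition A_lt : pred anyperm := [pred s | Delta_star s && acute s &&
  [exists x, (s == cycle_shape d x) && (cycle_peak d x < peak d)]].

Definition G_lt : pred anyperm := [pred s | Delta_star s && grave s &&
  [exists x, (s == cycle_shape d x) && (cycle_peak d x < peak d)]].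

End ShapeSets.

Section Sum.
Variables (k l : nat) (J : {set 'I_(k + l)}) (hJ : #|J| = k).

Lemma card_compl : #|~: J| = l.
Proof. by have := cardsC J; rewrite hJ card_ord => /addnI. Qed.

Lemma mem_compl x : x \notin J -> x \in ~: J.
Proof. by rewrite in_setC. Qed.

Variables (d1 : 'S_k) (d2 : 'S_l).

Definition osum_fun (x : 'I_(k + l)) : 'I_(k + l) :=
  match boolP (x \in J) with
  | AltTrue xJ => Omega hJ (d1 (Omega_inv hJ xJ))
  | AltFalse xJ => Omega card_compl (d2 (Omega_inv card_compl (mem_compl xJ)))
  end.

Lemma osum_fun_inj : injective osum_fun.
Proof.
move=> x y; rewrite /osum_fun.
have disj i j : Omega hJ i <> Omega card_compl j.
  move=> e; have := mem_Omega card_compl j.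
  by rewrite -e in_setC mem_Omega.
case: {-}_ / boolP => xJ; case: {-}_ / boolP => yJ.
- by move=> /Omega_inj/perm_inj/(congr1 (Omega hJ)); rewrite !Omega_invK.
- by move=> /disj.
- by move=> /esym/disj.
- by move=> /Omega_inj/perm_inj/(congr1 (Omega card_compl)); rewrite !Omega_invK.
Qed.

Definition osum : 'S_(k + l) := perm osum_fun_inj.

Lemma osum_Omega i : osum (Omega hJ i) = Omega hJ (d1 i).
Proof.
rewrite permE /osum_fun; case: {-}_ / boolP => iJ; first by rewrite OmegaK.
by case/negP: (iJ); rewrite mem_Omega.
Qed.

Lemma osum_Omega_compl j :
  osum (Omega card_compl j) = Omega card_compl (d2 j).
Proof.
rewrite permE /osum_fun; case: {-}_ / boolP => jJ; last by rewrite OmegaK.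
by have := mem_Omega card_compl j; rewrite in_setC jJ.
Qed.

End Sum.

(* m_1 precedes m_2 in the sum over J. *)
Definition peaks_ordered (n1 n2 : nat) (d1 : 'S_n1.+1) (d2 : 'S_n2.+1)
    (J : {set 'I_(n1.+1 + n2.+1)}) (hJ : #|J| = n1.+1) : bool :=
  Omega hJ (peak d1) < Omega (card_compl hJ) (peak d2).

(* Main.v *)
Require Import Defs.
From mathcomp Require Import all_boot all_fingroup.
From mathcomp Require Import all_order all_algebra zify.

(* Cut the domain of a unimodal permutation at its peak, which may go to either
   side.  Reading off the sides visited by a point gives its itinerary, and the
   itineraries determine the order of the points except among points that share
   one.  A sum in which the peak of d1 precedes that of d2 is bitonic with the
   peak of d1 on the left and the peak of d2 on the right, so its itineraries are
   prescribed; this gives uniqueness, because the permutation is monotone from a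
   class of equal itineraries to the next one.

   A cycle with an odd number of points on the right and a disjoint copy with the
   same sides cannot coexist: going once around the cycle would reverse the order
   of the two copies of a point.  Acute and grave are this parity, according to
   the side of the peak, so this gives all the obstructions.  Conversely, order
   the points by itinerary and, inside a class, nest the points of d2 in the
   middle of those of d1; this is compatible with the monotone maps between the
   classes unless both summands have a middle point.  Two middle points have
   cycles of the same shape, and they can be ordered consistently along these
   cycles when the number of points on the right is even. *)

Set Implicit Arguments.
Unset Strict Implicit.
Unset Printing Implicit Defensive.

Import Order.TTheory GRing.Theory Num.Theory.

(** * Bitonic permutations and sums *)

(** [r] is the part to the right of the cut. Keeping it as a predicate leaves open on which side the
    peak lies and lets the cut be pulled back along increasing maps. *)
Definition bitonic n (s : 'S_n) (r : pred 'I_n) : Prop :=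
  forall x y : 'I_n, x < y ->
  [/\ r x -> r y, ~~ r y -> s x < s y & r x -> s y < s x].

Lemma bitonic_ltn n (s : 'S_n) r (x y : 'I_n) :
  bitonic s r -> r x = r y -> (s x < s y) = (if r x then y < x else x < y).
Proof.
move=> sr; case: (ltngtP x y) => [xy|yx|/val_inj->]; last by rewrite ltnn if_same.
  case: (sr _ _ xy) => _ u w e; case: ifP => rx; last by apply: u; rewrite -e rx.
  by apply/negbTE; rewrite -leqNgt ltnW ?w.
case: (sr _ _ yx) => _ u w e; case: ifP => rx; first by apply: w; rewrite -e.
by apply/negbTE; rewrite -leqNgt ltnW ?u ?rx.
Qed.

(** The summands of a sum and the shapes of its cycles inherit their cut in this way. *)
Lemma bitonic_comp n k (s : 'S_n) (p : 'S_k) r (a : 'I_k -> 'I_n) :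
  bitonic s r -> {homo a : i j / i < j} -> (forall i, s (a i) = a (p i)) ->
  bitonic p (r \o a).
Proof.
move=> sr a_lt sa.
have a_mono i j : (a i < a j) = (i < j).
  case: (ltngtP i j) => [/a_lt//|/a_lt ji|/val_inj->]; last by rewrite ltnn.
  by apply/negbTE; rewrite -leqNgt ltnW.
by move=> i j /a_lt/sr[]; rewrite /= !sa !a_mono.
Qed.

(** On the wrong side, monotonicity would give the peak a smaller value than [x]. Hence the side of
    the peak is the only freedom in a cut. *)
Lemma bitonic_side n (s : 'S_n) r (m x : 'I_n) :
  bitonic s r -> (forall y, s y <= s m) -> x != m -> r x = (m < x).
Proof.
move=> sr sm; rewrite neq_ltn => /orP[xm|mx].
  case: (sr _ _ xm) => _ _ w; rewrite ltnNge ltnW //=.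
  by apply/negP => /w; rewrite ltnNge sm.
case: (sr _ _ mx) => _ u _; rewrite mx; apply: contraT => /u.
by rewrite ltnNge sm.
Qed.

Lemma bitonic_unimodal n (s : 'S_n.+1) r : bitonic s r -> unimodal s.
Proof.
move=> sr; pose m := [arg max_(y > ord0) (s y : nat)].
have sm y : s y <= s m by rewrite /m; case: arg_maxnP => // i _; apply.
have sm' y : y != m -> s y < s m.
  by rewrite ltn_neqAle sm andbT; apply: contra => /eqP/val_inj/perm_inj->.
apply/existsP; exists m; apply/forallP=> a; apply/forallP=> b.
apply/andP; split; apply/implyP=> /andP[].
  move=> ab bm; case: (eqVneq b m) => [->|b_m].
    by apply: sm'; apply: contraTneq (leq_trans ab bm) => ->; rewrite ltnn.
  case: (sr _ _ ab) => _ u _; apply: u; rewrite (bitonic_side sr sm b_m).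
  by rewrite -leqNgt.
move=> ma ab; case: (eqVneq a m) => [->|a_m].
  by apply: sm'; apply: contraTneq ab => ->; rewrite -leqNgt.
case: (sr _ _ ab) => _ _; apply; rewrite (bitonic_side sr sm a_m).
by rewrite ltn_neqAle ma eq_sym a_m.
Qed.

Lemma unimodal_bitonic n (s : 'S_n) : unimodal s ->
  exists m : 'I_n, [/\ bitonic s (fun x => m < x), bitonic s (fun x => m <= x)
                     & forall x, s x <= s m].
Proof.
case/existsP=> m /forallP sm; exists m.
have lo (a b : 'I_n) : a < b <= m -> s a < s b.
  by move=> h; have /forallP/(_ b)/andP[/implyP/(_ h)] := sm a.
have hi (a b : 'I_n) : m <= a < b -> s b < s a.
  by move=> h; have /forallP/(_ b)/andP[_ /implyP/(_ h)] := sm a.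
split.
- move=> x y xy; split=> [mx|my|mx]; first exact: ltn_trans xy.
    by apply: lo; rewrite xy leqNgt.
  by apply: hi; rewrite ltnW.
- move=> x y xy; split=> [mx|my|mx]; first exact: leq_trans (ltnW xy).
    by apply: lo; rewrite xy ltnW // ltnNge.
  by apply: hi; rewrite mx.
move=> x; case: (ltngtP x m) => [xm|mx|/val_inj-> //]; apply: ltnW.
  by apply: lo; rewrite xm /=.
by apply: hi; rewrite leqnn.
Qed.

Lemma peakP n (d : 'S_n.+1) x : d x <= d (peak d).
Proof. by rewrite /peak permKV -ltnS. Qed.

Lemma peak_uniq n (d : 'S_n.+1) m : (forall x, d x <= d m) -> m = peak d.
Proof.
move=> dm; apply: (@perm_inj _ d); apply: val_inj; apply/eqP.
by rewrite eqn_leq dm peakP.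
Qed.

Lemma card_ord_ltn n m : m <= n -> #|[pred i : 'I_n | i < m]| = m.
Proof.
by move=> mn; rewrite -sum1_card -(big_ord_widen _ (fun=> 1)) // sum1_card card_ord.
Qed.

(** The value of a permutation at [x] is the number of points with a smaller image. *)
Lemma perm_eq_order n (s t : 'S_n) :
  (forall x y, (s x < s y) = (t x < t y)) -> s = t.
Proof.
move=> st; apply/permP => x; apply: val_inj => /=.
have rank (u : 'S_n) : #|[pred y | u y < u x]| = u x :> nat.
  rewrite -(card_image (@perm_inj _ u)) -[RHS](card_ord_ltn (ltnW (ltn_ord (u x)))).
  apply: eq_card => y; rewrite inE; apply/imageP/idP => [[z zx ->]//|yx].
  by exists (u^-1 y)%g; rewrite ?inE permKV.
by rewrite -(rank s) -(rank t); apply: eq_card => y; rewrite !inE st.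
Qed.

Section Merge.
Variables (k l : nat).
Local Notation T := ('I_k + 'I_l)%type.

Definition interleave (J : {set 'I_(k + l)}) (hJ : #|J| = k) (z : T) : 'I_(k + l) :=
  match z with inl x => Omega hJ x | inr y => Omega (card_compl hJ) y end.

Lemma interleave_inj (J : {set 'I_(k + l)}) (hJ : #|J| = k) : injective (interleave hJ).
Proof.
have disj x y : Omega hJ x <> Omega (card_compl hJ) y.
  by move=> e; have := mem_Omega (card_compl hJ) y; rewrite -e in_setC mem_Omega.
case=> x [] y /=; first by move/Omega_inj->.
- by move/disj.
- by move/esym/disj.
- by move/Omega_inj->.
Qed.

Lemma interleave_bij (J : {set 'I_(k + l)}) (hJ : #|J| = k) : bijective (interleave hJ).
Proof.
by apply: inj_card_bij; [apply: interleave_inj | rewrite card_sum !card_ord].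
Qed.

Definition sum_map (d1 : 'S_k) (d2 : 'S_l) (z : T) : T :=
  match z with inl x => inl (d1 x) | inr y => inr (d2 y) end.

Lemma osum_interleave (J : {set 'I_(k + l)}) (hJ : #|J| = k) d1 d2 z :
  osum hJ d1 d2 (interleave hJ z) = interleave hJ (sum_map d1 d2 z).
Proof. by case: z => x /=; rewrite ?osum_Omega ?osum_Omega_compl. Qed.

End Merge.

Lemma Omega_homo n k (J : {set 'I_n}) (hJ : #|J| = k) :
  {homo Omega hJ : i j / i < j}.
Proof. by move=> i j; rewrite ltn_Omega. Qed.

(** Composing [a] with the inverse of [Omega] gives an increasing permutation, which is the
    identity. *)
Lemma homo_Omega n k (J : {set 'I_n}) (hJ : #|J| = k) (a : 'I_k -> 'I_n) :
  {homo a : i j / i < j} -> (forall i, a i \in J) -> a =1 Omega hJ.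
Proof.
move=> a_lt aJ; pose g i := Omega_inv hJ (aJ i).
have gE i : Omega hJ (g i) = a i by rewrite Omega_invK.
have g_lt i j : (g i < g j) = (i < j).
  have g_homo (i' j' : 'I_k) : i' < j' -> g i' < g j'.
    by move=> /a_lt; rewrite -!gE ltn_Omega.
  case: (ltngtP i j) => [/g_homo//|/g_homo ji|/val_inj->]; last by rewrite ltnn.
  by apply/negbTE; rewrite -leqNgt ltnW.
have g_inj : injective g.
  move=> i j e; have := g_lt i j; have := g_lt j i; rewrite e ltnn.
  by case: ltngtP => // /val_inj.
have /permP g1 : perm g_inj = 1%g.
  by apply: perm_eq_order => i j; rewrite !perm1 !permE g_lt.
by move=> i; rewrite -gE; have := g1 i; rewrite permE perm1 => ->.
Qed.

(** * Cycles and their shapes *)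

(** Let [b i] say that the first copy of [i] precedes the second. From [i] to [p i] it flips exactly
    when the copies are on the right. Summed modulo 2 over all [i], the values of [b] cancel, since
    [p] permutes the indices, and the parity of the right part remains. *)
Lemma no_conjugate_pair n k (s : 'S_n) r (p : 'S_k) (a1 a2 : 'I_k -> 'I_n) :
    bitonic s r -> (forall i, s (a1 i) = a1 (p i)) ->
    (forall i, s (a2 i) = a2 (p i)) -> (forall i, a1 i != a2 i) ->
    (forall i, r (a1 i) = r (a2 i)) ->
  ~~ odd #|[pred i | r (a1 i)]|.
Proof.
move=> sr sa1 sa2 a12 r12; pose b i := a1 i < a2 i.
have bp i : b (p i) = b i (+) r (a1 i).
  rewrite /b -sa1 -sa2 (bitonic_ltn sr (r12 i)).
  case: ifP => _; last by rewrite addbF.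
  by rewrite addbT; case: ltngtP (a12 i) => // /val_inj->; rewrite eqxx.
have par (q : pred 'I_k) : odd #|q| = \big[addb/false]_i q i.
  rewrite -sum1_card big_mkcond (big_morph odd oddD (erefl : odd 0 = false)).
  by apply: eq_bigr => i _; rewrite unfold_in; case: (q i).
have : \big[addb/false]_i b i = \big[addb/false]_i b (p i).
  exact: (reindex_inj (@perm_inj _ p)).
under [RHS]eq_bigr => i _ do rewrite bp.
rewrite big_split /= -[LHS]addbF => /addbI; rewrite par => <-.
by [].
Qed.

(** The right part consists of the [k - i0.+1] points after the peak, and of the peak itself if
    [r i0]. Acute means that [k - i0.+1] is even. *)
Lemma odd_card_side k (p : 'S_k) r (i0 : 'I_k) :
    bitonic p r -> (forall i, p i <= p i0) ->
  odd #|[pred i | r i]| = (acute (Tagged (fun k => 'S_k) p) == r i0).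
Proof.
move=> pr pi0.
have pmax : p i0 = k.-1 :> nat.
  apply/eqP; rewrite eqn_leq; case: k p r i0 pr pi0 => [|k] p r i0 _ pi0.
    by case: (i0).
  rewrite -ltnS ltn_ord /=.
  by have := pi0 (p^-1 ord_max)%g; rewrite permKV.
have -> : acute (Tagged (fun k => 'S_k) p) = (odd k == odd i0.+1).
  apply/existsP/idP => /= [[i]|e]; last first.
    by exists i0; rewrite pmax eqxx !modn2 (eqP e) /=.
  rewrite -pmax => /andP[/eqP/val_inj/perm_inj->].
  by rewrite !modn2 /=; case: odd; case: odd.
have -> : #|[pred i | r i]| = r i0 + (k - i0.+1).
  rewrite (cardD1 i0) inE; congr (_ + _).
  have := cardC [pred i : 'I_k | i < i0.+1].
  rewrite card_ord card_ord_ltn // => kE.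
  have -> : k - i0.+1 = #|[predC [pred i : 'I_k | i < i0.+1]]|.
    by apply: (@addnI i0.+1); rewrite kE subnKC.
  apply: eq_card => i; rewrite !inE ltnS -ltnNge.
  have [->|ii0] := eqVneq i i0; first by rewrite ltnn.
  by rewrite (bitonic_side pr pi0 ii0).
by rewrite oddD oddB //= oddb; case: (odd k) (odd i0) (r i0) => [] [] [].
Qed.

(** With the degree [k] free, cycles of two permutations can be enumerated with literally the same
    [p], without casts between cardinals of orbits. *)
Definition parametrizes n (d : 'S_n) (x : 'I_n) k (p : 'S_k)
    (a : 'I_k -> 'I_n) : Prop :=
  [/\ {homo a : i j / i < j}, forall i, a i \in porbit d x,
      forall y, y \in porbit d x -> exists i, y = a i
    & forall i, d (a i) = a (p i)].

Lemma homo_ord_inj n k (a : 'I_k -> 'I_n) :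
  {homo a : i j / i < j} -> injective a.
Proof.
move=> a_lt i j e.
by case: (ltngtP i j) => [/a_lt|/a_lt|/val_inj//]; rewrite e ltnn.
Qed.

Lemma cycle_shape_parametrizes n (d : 'S_n) x :
  parametrizes d x (tagged (cycle_shape d x)) (Omega (erefl #|porbit d x|)).
Proof.
split.
- exact: Omega_homo.
- exact: mem_Omega.
- by move=> y yJ; exists (Omega_inv erefl yJ); rewrite Omega_invK.
by move=> i; rewrite permE /cshape_fun Omega_invK.
Qed.

Lemma parametrizes_cycle_shape n (d : 'S_n) x k (p : 'S_k) a :
  parametrizes d x p a -> cycle_shape d x = Tagged (fun k => 'S_k) p.
Proof.
case=> a_lt aJ a_onto da.
have hk : #|porbit d x| = k.
  rewrite -[RHS]card_ord -(card_codom (homo_ord_inj a_lt)).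
  apply: eq_card => y; apply/idP/codomP => [/a_onto//|[i ->]//].
case: k / hk p a a_lt aJ a_onto da => p a a_lt aJ a_onto da.
congr Tagged; apply/permP => i.
apply: (@Omega_inj _ _ (porbit d x) erefl).
by rewrite permE /cshape_fun Omega_invK -!(homo_Omega erefl a_lt aJ).
Qed.

Lemma parametrizes_peak n (d : 'S_n) x k (p : 'S_k) a (i0 : 'I_k) :
    parametrizes d x p a -> (forall i, p i <= p i0) ->
  cycle_peak d x = a i0.
Proof.
case=> a_lt aJ a_onto da pi0; rewrite /cycle_peak.
case: arg_maxnP => [|y /a_onto[i ->] ymax]; first exact: porbit_id.
congr a; apply/eqP/negPn/negP => ii0.
have := ymax _ (aJ i0); rewrite /= !da leqNgt a_lt //.
by rewrite ltn_neqAle pi0 andbT (inj_eq val_inj) (inj_eq perm_inj).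
Qed.

Lemma exists_max k (p : 'S_k) : 0 < k -> exists i0 : 'I_k, forall i, p i <= p i0.
Proof.
by case: k p => // k p _; exists (peak p) => i; apply: peakP.
Qed.

Lemma parametrizes_gt0 n (d : 'S_n) x k (p : 'S_k) a :
  parametrizes d x p a -> 0 < k.
Proof. by case=> _ _ /(_ _ (porbit_id d x))[] [i ik] _ _; apply: leq_ltn_trans ik. Qed.

Lemma parametrizes_iter n (d : 'S_n) x k (p : 'S_k) a i j :
  parametrizes d x p a -> a (iter j p i) = iter j d (a i).
Proof. by case=> _ _ _ da; elim: j => //= j <-; rewrite da. Qed.

Lemma parametrizes_Delta_star n (d : 'S_n) r x k (p : 'S_k) a :
  bitonic d r -> parametrizes d x p a -> Delta_star (Tagged (fun k => 'S_k) p).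
Proof.
move=> dr pa; have [a_lt aJ a_onto da] := pa.
apply/andP; split => /=.
  have k_gt0 := parametrizes_gt0 pa.
  case: k p a k_gt0 a_lt da {pa aJ a_onto} => // k p a _ a_lt da.
  exact: bitonic_unimodal (bitonic_comp dr a_lt da).
have [i0 _] := exists_max p (parametrizes_gt0 pa).
suff -> : porbits p = [set porbit p i0] by rewrite cards1.
apply/setP => B; rewrite inE; apply/imsetP/eqP => [[i _ ->]|->]; last by exists i0.
apply/eqP; rewrite eq_porbit_mem.
have : a i \in porbit d (a i0).
  by have := aJ i0; rewrite -eq_porbit_mem => /eqP->.
case/porbitP=> j; rewrite permX -(parametrizes_iter _ _ pa) => /(homo_ord_inj a_lt)->.
by rewrite -permX mem_porbit.
Qed.

Lemma cycle_peak_peak n (d : 'S_n.+1) : cycle_peak d (peak d) = peak d.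
Proof.
rewrite /cycle_peak; case: arg_maxnP => [|y _ ymax]; first exact: porbit_id.
apply: (@perm_inj _ d); apply: val_inj; apply/eqP.
by rewrite eqn_leq peakP; apply: ymax (porbit_id _ _).
Qed.

(** * Itineraries *)

Section Kneading.
Variables (T : Type) (f : T -> T) (r : pred T).
Implicit Types x y : T.

(* The sides of the first [d] points of the orbit of [x], as binary digits each of
   which is complemented after an odd number of visits to [r]: as for the tent
   map, this makes the code monotone. *)
Fixpoint kneading (d : nat) (x : T) : nat :=
  if d is d'.+1 then
    if r x then 2 ^ d - (kneading d' (f x)).+1 else kneading d' (f x)
  else 0.

Lemma kneading_ltn d x : kneading d x < 2 ^ d.
Proof.
elim: d x => //= d IH x; have := IH (f x); rewrite expnS.
by case: ifP => _; lia.
Qed.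

(** Complementing binary digits commutes with dropping the last one, so halving a code forgets the
    last point visited. *)
Lemma kneading_half d x : (kneading d.+1 x)./2 = kneading d x.
Proof.
elim: d x => [|d IH] x; first by rewrite /=; case: ifP.
have := IH (f x); have := kneading_ltn d.+1 (f x).
rewrite [kneading d.+2 x]/= [kneading d.+1 x]/= -/(kneading d.+1 (f x)) !expnS.
by case: ifP => _; lia.
Qed.

Lemma kneading_leq d x y :
  kneading d.+1 x <= kneading d.+1 y -> kneading d x <= kneading d y.
Proof. by rewrite -!(kneading_half d); apply: half_leq. Qed.

Lemma kneading_same_side d x y : r x = r y ->
  (kneading d.+1 x < kneading d.+1 y)
    = (if r x then kneading d (f y) < kneading d (f x)
       else kneading d (f x) < kneading d (f y)).
Proof.
have := kneading_ltn d (f x); have := kneading_ltn d (f y).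
by move=> /= + + <-; rewrite expnS; case: ifP => _; lia.
Qed.

Lemma kneading_other_side d x y :
  ~~ r x -> r y -> kneading d.+1 x < kneading d.+1 y.
Proof.
have := kneading_ltn d (f x); have := kneading_ltn d (f y).
by move=> /= + + /negbTE-> ->; rewrite expnS; lia.
Qed.

Lemma kneading_side d x y : kneading d.+1 x = kneading d.+1 y -> r x = r y.
Proof.
move=> e; case rx: (r x); case ry: (r y) => //.
  by have := @kneading_other_side d y x; rewrite rx ry e ltnn => ->.
by have := @kneading_other_side d x y; rewrite rx ry e ltnn => ->.
Qed.

(** The complementations can be undone from the leading digit on, so the code carries the same
    information as the list of sides. *)
Lemma kneading_eqP d x y :
  kneading d x = kneading d y <->
  (forall j, j < d -> r (iter j f x) = r (iter j f y)).
Proof.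
elim: d x y => [|d IH] x y //; split=> [e [_|j jd]|e].
- exact: kneading_side e.
- rewrite !iterSr; apply: (IH _ _).1 => //.
  move: (e) => /=; rewrite (kneading_side e).
  have := kneading_ltn d (f x); have := kneading_ltn d (f y).
  by rewrite expnS; case: ifP => _; lia.
have /IH e' : forall j, j < d -> r (iter j f (f x)) = r (iter j f (f y)).
  by move=> j jd; have := e j.+1; rewrite !iterSr; apply.
by rewrite /= e'; have /= -> := e 0 isT.
Qed.

End Kneading.

Lemma kneading_morph (T T' : Type) f r (f' : T' -> T') r' (a : T -> T') d x :
    (forall z, f' (a z) = a (f z)) -> (forall z, r' (a z) = r z) ->
  kneading f' r' d (a x) = kneading f r d x.
Proof. by move=> fa ra; elim: d x => //= d IH x; rewrite ra fa !IH. Qed.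

(** On different sides the leading digit decides. On the same side [s] keeps or reverses the order,
    and in the latter case the rest of the code is complemented. *)
Lemma kneading_homo n (s : 'S_n) r d (x y : 'I_n) :
  bitonic s r -> x <= y -> kneading s r d x <= kneading s r d y.
Proof.
move=> sr; elim: d x y => // d IH x y.
rewrite leq_eqVlt => /predU1P[/val_inj-> //|xy]; have [rxy u w] := sr _ _ xy.
case: (boolP (r x)) => rx; last first.
  case: (boolP (r y)) => ry; first exact/ltnW/kneading_other_side.
  rewrite leqNgt kneading_same_side ?(negbTE rx) ?(negbTE ry) //.
  by rewrite -leqNgt IH // ltnW // u.
rewrite leqNgt kneading_same_side ?rxy // -leqNgt.
by rewrite IH // ltnW // w.
Qed.

(** Both sequences of values are the sorted form of one multiset. *)
Lemma sorted_codom_eq n (u v : 'I_n -> nat) :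
    {homo u : i j / i <= j} -> {homo v : i j / i <= j} ->
  perm_eq (codom u) (codom v) -> u =1 v.
Proof.
move=> u_le v_le uv.
have srt (g : 'I_n -> nat) : {homo g : i j / i <= j} -> sorted leq (codom g).
  move=> g_le; rewrite /codom /image_mem sorted_map enumT.
  have : sorted leq (map val (Finite.enum 'I_n)).
    by rewrite -enumT val_enum_ord iota_sorted.
  by rewrite sorted_map; apply: sub_sorted => i j /g_le.
have /eq_in_map e : codom u = codom v.
  by apply: (sorted_eq leq_trans anti_leq) => //; apply: srt.
by move=> i; apply: e; rewrite mem_enum.
Qed.

(* Both permutations have the codes of [f], hence the same code at each point,
   and codes longer than the period determine the order of the images. *)
Lemma bitonic_conjugate_uniq n (T : finType) (f : T -> T) (side : pred T)
    (s s' : 'S_n) r r' (a a' : T -> 'I_n) :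
    bijective a -> bijective a' ->
    (forall z, s (a z) = a (f z)) -> (forall z, s' (a' z) = a' (f z)) ->
    bitonic s r -> bitonic s' r' ->
    (forall z, r (a z) = side z) -> (forall z, r' (a' z) = side z) ->
  s = s'.
Proof.
move=> a_bij a'_bij sa sa' sr sr' ra ra'.
have codom_comp (b : T -> 'I_n) (u : 'I_n -> nat) :
    bijective b -> perm_eq (codom u) (codom (u \o b)).
  move=> b_bij; rewrite /codom /image_mem (map_comp u b).
  apply: perm_map; apply: uniq_perm; rewrite ?enum_uniq //.
    by rewrite (map_inj_uniq (bij_inj b_bij)) enum_uniq.
  case: b_bij => c bc cb i; rewrite mem_enum; apply/esym/mapP.
  by exists (c i); rewrite ?mem_enum ?cb.
have same_code d : kneading s r d =1 kneading s' r' d.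
  apply: sorted_codom_eq; try by move=> i j; apply: kneading_homo.
  rewrite (perm_trans (codom_comp a _ a_bij)) //.
  rewrite perm_sym (perm_trans (codom_comp a' _ a'_bij)) //.
  suff -> : codom (kneading s' r' d \o a') = codom (kneading s r d \o a) by [].
  apply: eq_codom => z /=.
  by rewrite (kneading_morph _ _ sa ra) (kneading_morph _ _ sa' ra').
have rr' i : r i = r' i.
  by have := same_code 1 i => /=; case: (r i); case: (r' i).
have same_image d i : kneading s r d (s i) = kneading s r d (s' i).
  rewrite [RHS]same_code; have := same_code d.+1 i.
  have := kneading_ltn s r d (s i); have := kneading_ltn s' r' d (s' i).
  by rewrite /= rr' expnS; case: ifP => _; lia.
apply: perm_eq_order => x y; pose d := #[s]%g.
have code_lt i j : kneading s r d i < kneading s r d j -> i < j.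
  move=> lt; rewrite ltnNge; apply: contraL lt => /(kneading_homo d sr).
  by rewrite -leqNgt.
case: (ltngtP (kneading s r d (s x)) (kneading s r d (s y))) => [lt|lt|e].
- by rewrite !code_lt // -!same_image.
- by rewrite !(leq_gtF (ltnW (code_lt _ _ _))) // -!same_image.
(* As [d] is a period, the last of the [d] points visited from [s x] is [x] itself. Equal codes of
   the images thus put [x] and [y] on the same side, where both permutations are monotone in the
   same sense. *)
have rxy : r x = r y.
  have iterK z : iter d.-1 s (s z) = z.
    by rewrite -iterSr prednK ?order_gt0 // -permX expg_order perm1.
  rewrite -(iterK x) -(iterK y); apply: (kneading_eqP s r d _ _).1 => //.
  by rewrite ltn_predL order_gt0.
by rewrite (bitonic_ltn sr rxy) (bitonic_ltn sr') -?rr' // rr'.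
Qed.

(** * Ordering by itinerary *)

(** Each point is placed at its rank by [key], and [J] collects the ranks of the first summand.
    Ranks increase on each summand, so they agree with the increasing bijections of the sum. *)
Lemma exists_interleave k l disp (D : orderType disp) (key : 'I_k + 'I_l -> D) :
    injective key ->
    (forall i j : 'I_k, i < j -> (key (inl i) < key (inl j))%O) ->
    (forall i j : 'I_l, i < j -> (key (inr i) < key (inr j))%O) ->
  exists (J : {set 'I_(k + l)}) (hJ : #|J| = k),
    forall z z', (interleave hJ z < interleave hJ z') = (key z < key z')%O.
Proof.
move=> key_inj key1 key2.
pose rk z := #|[pred u | (key u < key z)%O]|.
have rk_homo z z' : (key z < key z')%O -> rk z < rk z'.
  move=> lt; apply: proper_card; apply/properP; split.
    by apply/subsetP => u; rewrite !inE => /lt_trans; apply.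
  by exists z; rewrite !inE ?ltxx.
have rk_ltn z : rk z < k + l.
  rewrite -[k]card_ord -[l]card_ord -card_sum; apply: proper_card.
  by apply/properP; split; [exact/subsetP | exists z; rewrite ?inE ?ltxx].
have rk_lt z z' : (rk z < rk z') = (key z < key z')%O.
  case: (ltgtP (key z) (key z')) => [/rk_homo//|/rk_homo lt|/key_inj->].
    by apply/negbTE; rewrite -leqNgt ltnW.
  by rewrite ltnn.
pose R z : 'I_(k + l) := Ordinal (rk_ltn z).
have R_inj : injective R.
  move=> z z' /(congr1 val)/= e; apply: key_inj.
  by case: (ltgtP (key z) (key z')) => // /rk_homo; rewrite e ltnn.
pose J := [set R (inl i) | i : 'I_k].
have hJ : #|J| = k by rewrite card_imset ?card_ord // => i j /R_inj[].
exists J, hJ => z z'; suff RE : R =1 interleave hJ by rewrite -!RE -rk_lt.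
case=> i /=.
  apply: (@homo_Omega _ _ _ hJ (R \o inl)) => [a b ab|a] /=.
    by rewrite rk_lt key1.
  exact: imset_f.
apply: (@homo_Omega _ _ _ (card_compl hJ) (R \o inr)) => [a b ab|a] /=.
  by rewrite rk_lt key2.
by rewrite inE; apply/imsetP => -[b _ /R_inj].
Qed.

Section Periodic.
Variables (T : finType) (f : T -> T) (r : pred T) (o : nat).
Hypotheses (o_gt0 : 0 < o) (fo : forall x, iter o f x = x).
Local Notation v := (kneading f r o).

Lemma iter_period j x : iter j f x = iter (j %% o) f x.
Proof.
rewrite {1}(divn_eq j o) addnC iterD; congr iter.
by elim: (j %/ o) => // m IH; rewrite mulSn iterD IH fo.
Qed.

Lemma itinerary_eqP x y :
  v x = v y <-> forall j, r (iter j f x) = r (iter j f y).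
Proof.
rewrite kneading_eqP; split=> e j => [|_]; last exact: e.
by rewrite !(iter_period j) e ?ltn_pmod.
Qed.

(** A periodic itinerary is recovered from its shift by going around the period. *)
Lemma itinerary_eq_map x y : v (f x) = v (f y) <-> v x = v y.
Proof.
rewrite !itinerary_eqP; split=> e j; last by rewrite -!iterSr.
by have := e (j + o.-1); rewrite -!iterSr -addnS prednK // !iterD !fo.
Qed.

(** The hypothesis compares the codes of the images only up to length [o.-1]; a strict inequality
    persists when codes are lengthened. *)
Lemma itinerary_lt_map x y : r x = r y -> v x < v y ->
  if r x then v (f y) < v (f x) else v (f x) < v (f y).
Proof.
case: o o_gt0 => // d _ rxy; rewrite kneading_same_side //.
by case: ifP => _; apply: contraLR; rewrite -!leqNgt; apply: kneading_leq.
Qed.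

Lemma itinerary_side x y : v x = v y -> r x = r y.
Proof. by move/itinerary_eqP/(_ 0). Qed.

Lemma itinerary_lt_side x y : ~~ r x -> r y -> v x < v y.
Proof. by case: o o_gt0 => // d _; apply: kneading_other_side. Qed.

(** Since the order is to be reversed on the right side, a quantity ordering the points of one
    itinerary has to change sign there. *)
Definition twisted (g : T -> int) : Prop :=
  forall x, g (f x) = (if r x then - g x else g x)%R.

Definition key (g : T -> int) x : (nat *l int)%type := (v x, g x).

Lemma key_ltE g x y :
  (key g x < key g y)%O = (v x < v y) || (v x == v y) && (g x < g y)%R.
Proof.
rewrite ltEprodlexi /= !leEnat.
by case: (ltngtP (v x) (v y)) => //=.
Qed.

Lemma key_lt_map g x y : twisted g -> r x = r y -> (key g x < key g y)%O ->
  if r x then (key g (f y) < key g (f x))%O else (key g (f x) < key g (f y))%O.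
Proof.
move=> gf rxy; rewrite !key_ltE => /orP[/(itinerary_lt_map rxy)|].
  by case: ifP => _ ->.
case/andP=> /eqP vxy gxy; have /itinerary_eq_map-> := vxy.
by rewrite !gf -rxy eqxx; case: (r x); rewrite ?ltrN2 gxy orbT.
Qed.

(* The double cover of the cycles of [f] with monodromy [r]: a cycle lifts to two
   cycles if [r] holds an even number of times along it, and to one otherwise.
   Comparing the two lifts of a point gives a twisted function which vanishes
   only in the second case. *)
Definition lift_map (z : T * bool) : T * bool := (f z.1, r z.1 (+) z.2).

Definition orientation x : int :=
  sgz ((enum_rank (froot lift_map (x, true)))%:Z
       - (enum_rank (froot lift_map (x, false)))%:Z)%R.

Lemma periodic_inj : injective f.
Proof.
by move=> x y e; rewrite -(fo x) -(fo y) -(prednK o_gt0) !iterSr e.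
Qed.

Lemma lift_map_inj : injective lift_map.
Proof. by move=> [x b] [y c] [/periodic_inj<- /addbI->]. Qed.

(** Passing from [x] to [f x] exchanges the two lifts exactly when [r x]. *)
Lemma twisted_orientation : twisted orientation.
Proof.
move=> x; have root b : froot lift_map (f x, r x (+) b) = froot lift_map (x, b).
  apply/eqP; rewrite eq_sym root_connect; last exact/fconnect_sym/lift_map_inj.
  exact: (fconnect1 lift_map (x, b)).
have := root false; have := root true; rewrite /orientation.
by case: (r x) => /= <- <- //; rewrite -sgzN opprB.
Qed.

(** If both lifts lie on one cycle, the path from one to the other projects to a closed path with an
    odd number of visits to [r]. *)
Lemma orientation_eq0 x : orientation x = 0%R ->
  exists j, iter j f x = x /\ odd (\sum_(i < j) r (iter i f x)).
Proof.
move=> /eqP; rewrite sgz_eq0 subr_eq0 eqz_nat (inj_eq val_inj).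
rewrite (inj_eq enum_rank_inj) eq_sym root_connect; last exact/fconnect_sym/lift_map_inj.
move/iter_findex; set j := findex _ _ _ => ej; exists j.
have iter_lift i b : iter i lift_map (x, b)
    = (iter i f x, odd (\sum_(u < i) r (iter u f x)) (+) b).
  elim: i => [|i IH]; first by rewrite big_ord0.
  by rewrite iterS IH /lift_map big_ord_recr /= oddD oddb -addbA addbCA.
by move: ej; rewrite iter_lift addbF => -[-> ->].
Qed.

Lemma orientation_le x : (`|orientation x| <= 1)%R.
Proof. by rewrite /orientation; case: sgzP. Qed.

End Periodic.

(** Remove one turn of length [q] from the closed path: either that turn is odd, or the shorter path
    still is. A closed path shorter than [q] is empty. *)
Lemma odd_card_porbit n (d : 'S_n) (r : pred 'I_n) y j :
    iter j d y = y -> odd (\sum_(i < j) r (iter i d y)) ->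
  odd #|[pred z in porbit d y | r z]|.
Proof.
set q := #|porbit d y|.
have -> : #|[pred z in porbit d y | r z]| = \sum_(i < q) r (iter i d y).
  have u := uniq_traject_porbit d y.
  have -> : #|[pred z in porbit d y | r z]| = count r (traject d y q).
    rewrite -size_filter -(card_uniqP (filter_uniq r u)).
    by apply: eq_card => z; rewrite !inE mem_filter -porbit_traject andbC.
  elim: q => [|m IH]; first by rewrite big_ord0.
  by rewrite trajectSr -cats1 count_cat IH big_ord_recr /= addn0.
have q_gt0 : 0 < q by rewrite lt0n card_porbit_neq0.
elim/ltn_ind: j => j IH dj odd_j; have [jq|qj] := ltnP j q.
  have j0 : j = 0.
    have := uniq_traject_porbit d y; rewrite -/q => u.
    have := nth_uniq y (_ : j < size (traject d y q)) (_ : 0 < size (traject d y q)) u.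
    rewrite size_traject !nth_traject // => /(_ jq q_gt0).
    by rewrite dj eqxx => /esym/eqP.
  by move: odd_j; rewrite j0 big_ord0.
move: odd_j; rewrite -(subnKC qj) big_split_ord /= oddD.
have iter_q i : iter (q + i) d y = iter i d y by rewrite addnC iterD iter_porbit.
move: IH; case: (odd (\sum_(i < q) _)) => //= IH; under eq_bigr => i _ do rewrite iter_q.
apply: IH; first by rewrite ltn_subrL q_gt0 (leq_trans q_gt0).
by rewrite -iter_q subnKC.
Qed.

(** Choose for each point of the cycle of [x] a time at which it is reached, and follow [y] for the
    same time. Times that agree for [x] agree for [y], since neither iterate is smaller, so this
    enumerates the cycle of [y] increasingly. *)
Lemma same_order_cycle_shape n n' (d : 'S_n) (d' : 'S_n') x y :
    (forall i j, (iter i d x < iter j d x) = (iter i d' y < iter j d' y)) ->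
  exists k (p : 'S_k) a b, [/\ parametrizes d x p a, parametrizes d' y p b
    & forall i, exists j, a i = iter j d x /\ b i = iter j d' y].
Proof.
move=> xy; pose a := Omega (erefl #|porbit d x|).
have pa := cycle_shape_parametrizes d x; have [a_lt aJ a_onto da] := pa.
have time i : exists j, a i == iter j d x.
  by have /porbitP[j ai] := aJ i; exists j; rewrite -permX; apply/eqP.
have [t aE] : exists t, forall i, a i = iter (t i) d x.
  by exists (fun i => xchoose (time i)) => i; apply/eqP/(xchooseP (time i)).
pose b i := iter (t i) d' y.
have iter_eq i j : iter i d x = iter j d x -> iter i d' y = iter j d' y.
  move=> e; apply: val_inj.
  by have := xy i j; have := xy j i; rewrite e ltnn; case: ltngtP.
exists _, (tagged (cycle_shape d x)), a, b; split => //; last first.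
  by move=> i; exists (t i).
split.
- by move=> i j /a_lt; rewrite -/(a i) -/(a j) !aE xy.
- by move=> i; rewrite /b -permX mem_porbit.
- move=> z /porbitP[j ->]; rewrite permX.
  have [i ai] : exists i, iter j d x = a i by apply: a_onto; rewrite -permX mem_porbit.
  by exists i; apply: iter_eq; rewrite -aE.
by move=> i; rewrite /b -iterS; apply: iter_eq; rewrite iterS -!aE da.
Qed.

Lemma parametrizes_card n (d : 'S_n) x k (p : 'S_k) a (r : pred 'I_n) :
  parametrizes d x p a -> #|[pred i | r (a i)]| = #|[pred z in porbit d x | r z]|.
Proof.
case=> a_lt aJ a_onto _; rewrite -(card_image (homo_ord_inj a_lt)).
apply: eq_card => z; rewrite !inE; apply/imageP/andP => [[i ri ->]//|[/a_onto[i ->] ri]].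
by exists i.
Qed.

(** * Construction of a sum *)

Section Existence.
Variables (k l : nat) (d1 : 'S_k) (d2 : 'S_l).
Local Notation T := ('I_k + 'I_l)%type.
Variable side : pred T.
Hypotheses (bit1 : bitonic d1 (side \o inl)) (bit2 : bitonic d2 (side \o inr)).

Local Notation f := (sum_map d1 d2).
Let o := #[d1]%g * #[d2]%g.
Local Notation v := (kneading f side o).

(** Points of different summands stay incomparable: their relative order is what has to be
    constructed. *)
Definition summand_lt (z z' : T) : bool :=
  match z, z' with
  | inl x, inl y => x < y
  | inr x, inr y => x < y
  | _, _ => false
  end.
Local Notation lt := summand_lt.

Lemma iter_inl j x : iter j f (inl x) = inl (iter j d1 x).
Proof. by elim: j => //= j ->. Qed.

Lemma iter_inr j y : iter j f (inr y) = inr (iter j d2 y).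
Proof. by elim: j => //= j ->. Qed.

Lemma sum_period_gt0 : 0 < o.
Proof. by rewrite muln_gt0 !order_gt0. Qed.

Lemma iter_sum_period z : iter o f z = z.
Proof.
case: z => x; rewrite ?iter_inl ?iter_inr -permX.
  by rewrite expgM expg_order expg1n perm1.
by rewrite /o mulnC expgM expg_order expg1n perm1.
Qed.

Let f_inj := periodic_inj sum_period_gt0 iter_sum_period.

Lemma summand_lt_map z z' : side z = side z' ->
  lt (f z) (f z') = if side z then lt z' z else lt z z'.
Proof.
case: z z' => x [] y //= e; try by rewrite if_same.
  exact: (bitonic_ltn bit1 e).
exact: (bitonic_ltn bit2 e).
Qed.

Lemma kneading_inl d x : kneading f side d (inl x) = kneading d1 (side \o inl) d x.
Proof. exact: (kneading_morph (a := inl)). Qed.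

Lemma kneading_inr d y : kneading f side d (inr y) = kneading d2 (side \o inr) d y.
Proof. exact: (kneading_morph (a := inr)). Qed.

Lemma summand_lt_kneading z z' : lt z z' -> v z <= v z'.
Proof.
case: z z' => x [] y // /ltnW xy; rewrite ?kneading_inl ?kneading_inr.
  exact: kneading_homo bit1 xy.
exact: kneading_homo bit2 xy.
Qed.

Lemma summand_lt_trans : transitive lt.
Proof. by case=> y [] x [] z //=; apply: ltn_trans. Qed.

Lemma summand_lt_irr : irreflexive lt.
Proof. by case=> x /=; rewrite ltnn. Qed.

Definition below z := #|[pred u | (v u == v z) && lt u z]|.
Definition above z := #|[pred u | (v u == v z) && lt z u]|.

(* The rank of [z], measured from the middle, among the points of its summand
   that have the same itinerary. *)
Definition centered_rank z : int := ((below z)%:Z - (above z)%:Z)%R.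
Local Notation h := centered_rank.

Lemma card_reindex (P : pred T) : #|[pred u | P u]| = #|[pred u | P (f u)]|.
Proof. by rewrite -!sum1_card (reindex_inj f_inj). Qed.

(** [f] maps the points sharing the itinerary of [z] onto those sharing that of [f z], and either
    keeps or exchanges below and above. *)
Lemma twisted_centered_rank : twisted f side h.
Proof.
have eq_map u z : (v (f u) == v (f z)) = (v u == v z).
  by apply/eqP/eqP => /(itinerary_eq_map side sum_period_gt0 iter_sum_period).
move=> z; have [bE aE] : below (f z) = (if side z then above z else below z) /\
                         above (f z) = (if side z then below z else above z).
  rewrite /below /above; split; rewrite card_reindex; case: ifP => sz;
  apply: eq_card => u; rewrite !inE eq_map; case: eqP => //= vuz;
  have suz := itinerary_side sum_period_gt0 iter_sum_period vuz;
  rewrite summand_lt_map //;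
  by rewrite ?suz sz.
by rewrite /h bE aE; case: ifP; rewrite // opprB.
Qed.

Lemma centered_rank_lt z z' : v z = v z' -> lt z z' -> (h z < h z')%R.
Proof.
move=> vzz' zz'; have : below z < below z'.
  apply: proper_card; apply/properP; split.
    apply/subsetP => u; rewrite !inE -vzz' => /andP[-> /=] uz.
    exact: summand_lt_trans zz'.
  by exists z; rewrite !inE ?summand_lt_irr ?andbF // vzz' eqxx.
have : above z' <= above z.
  apply: subset_leq_card; apply/subsetP => u; rewrite !inE -vzz' => /andP[-> /=].
  exact: summand_lt_trans.
rewrite /h; lia.
Qed.

Lemma centered_rank_bound z : (`|h z| <= #|{: T}|%:Z)%R.
Proof.
by rewrite /h; have : below z <= #|{: T}| := max_card _;
  have : above z <= #|{: T}| := max_card _; lia.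
Qed.

(* The scaling nests the points of the second summand between those of negative
   and those of positive rank in the first; [orientation] separates the two
   middle points, and is too small to change the order otherwise. *)
Definition tie_break (z : T) : int :=
  match z with
  | inl _ => (3 * (#|{: T}| + 1)%:Z * h z)%R
  | inr _ => (3 * h z + orientation f side z)%R
  end.

Lemma twisted_tie_break : twisted f side tie_break.
Proof.
have e := twisted_orientation side sum_period_gt0 iter_sum_period.
have c := twisted_centered_rank.
case=> x; rewrite /tie_break /=.
  by have /= -> := c (inl x); case: ifP => _; rewrite ?mulrN.
have /= -> := c (inr x); have /= -> := e (inr x).
by case: ifP => _; rewrite ?mulrN ?opprD.
Qed.

Lemma tie_break_lt z z' : v z = v z' -> lt z z' -> (tie_break z < tie_break z')%R.
Proof.
case: z z' => x [] y // vxy xy; have := centered_rank_lt vxy xy.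
  by rewrite /tie_break; nia.
(* Two orientations differ by at most 2, less than the factor 3. *)
have := orientation_le f side (inr x); have := orientation_le f side (inr y).
rewrite /tie_break; move: (h _) (h _) (orientation _ _ _) (orientation _ _ _) => a b c d.
lia.
Qed.

Lemma middle_neq z z' : lt z z' || lt z' z -> h z = 0%R -> h z' = 0%R -> v z <> v z'.
Proof.
move=> /orP[] c h0 h0' e.
  by have := centered_rank_lt e c; rewrite h0 h0' ltxx.
by have := centered_rank_lt (esym e) c; rewrite h0 h0' ltxx.
Qed.

(** A tie forces both points to be middle points, and so are all their iterates. Distinct middle
    points of one summand have distinct itineraries, so both orbits are ordered by itinerary and
    hence alike; the vanishing orientation gives the odd parity. *)
Lemma tie_break_cross x y :
    v (inl x) = v (inr y) -> tie_break (inl x) = tie_break (inr y) ->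
  exists q (p : 'S_q) a b, [/\ parametrizes d1 x p a, parametrizes d2 y p b,
    forall i, side (inl (a i)) = side (inr (b i))
    & odd #|[pred i | side (inl (a i))]| ].
Proof.
move=> vxy txy.
have [hx hy ey] : [/\ h (inl x) = 0, h (inr y) = 0
                    & orientation f side (inr y) = 0]%R.
  move: txy; have := orientation_le f side (inr y).
  have := centered_rank_bound (inl x); have := centered_rank_bound (inr y).
  rewrite /tie_break; move: (h _) (h _) (orientation _ _ _) => u w e hu hw he E.
  rewrite -mulrA in E.
  (* Modulo 3 the orientation [e] vanishes, being at most 1 in absolute value. Then [w] is a
     multiple of a number exceeding its own bound, so [u] is 0 as well. *)
  have [e0 Ew] : (e = 0 /\ (#|{: T}| + 1)%:Z * u = w)%R by lia.
  have u0 : u = 0%R by nia.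
  by rewrite e0 -Ew u0 mulr0.
have h_iter z j : h z = 0%R -> h (iter j f z) = 0%R.
  move=> hz; elim: j => //= j IH; rewrite twisted_centered_rank IH.
  by rewrite oppr0 if_same.
have v_iter j : v (iter j f (inl x)) = v (iter j f (inr y)).
  by elim: j => //= j IH; apply/(itinerary_eq_map side sum_period_gt0 iter_sum_period).
have lt_iff z z' : h z = 0%R -> h z' = 0%R -> z = z' \/ lt z z' || lt z' z ->
    lt z z' = (v z < v z').
  move=> hz hz' [->|c]; first by rewrite summand_lt_irr ltnn.
  have /eqP := middle_neq c hz hz'; rewrite neq_ltn.
  case/orP: c => c; have := summand_lt_kneading c.
    by rewrite c; case: ltngtP.
  case: ltngtP => // _ _ _; apply/negbTE/negP => /(summand_lt_trans c).
  by rewrite summand_lt_irr.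
have cmp_l i j : inl i = inl j :> T \/ lt (inl i) (inl j) || lt (inl j) (inl i).
  case: (ltngtP i j) => [ij|ij|/val_inj->]; [right|right|left] => //=;
  by rewrite ij ?orbT.
have cmp_r i j : inr i = inr j :> T \/ lt (inr i) (inr j) || lt (inr j) (inr i).
  case: (ltngtP i j) => [ij|ij|/val_inj->]; [right|right|left] => //=;
  by rewrite ij ?orbT.
have order_eq i j : (iter i d1 x < iter j d1 x) = (iter i d2 y < iter j d2 y).
  rewrite -[LHS]/(lt (inl _) (inl _)) -[RHS]/(lt (inr _) (inr _)).
  rewrite -!iter_inl -!iter_inr (lt_iff (iter i f (inl x))) ?h_iter //.
    by rewrite (lt_iff (iter i f (inr y))) ?h_iter ?v_iter // !iter_inr.
  by rewrite !iter_inl.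
have [q [p [a [b [pa pb ab]]]]] := same_order_cycle_shape order_eq.
exists q, p, a, b.
have sab i : side (inl (a i)) = side (inr (b i)).
  have [j [-> ->]] := ab i; rewrite -iter_inl -iter_inr.
  exact: (itinerary_side sum_period_gt0 iter_sum_period).
split => //.
have -> : #|[pred i | side (inl (a i))]| = #|[pred i | side (inr (b i))]|.
  by apply: eq_card => i; rewrite !inE sab.
rewrite (parametrizes_card (fun z => side (inr z)) pb).
have [j [ej odd_j]] := orientation_eq0 sum_period_gt0 iter_sum_period ey.
apply: (@odd_card_porbit _ _ _ _ j); first by move: ej; rewrite iter_inr => -[].
by under eq_bigr => i _ do rewrite -iter_inr.
Qed.

(** The excluded pairs of cycles are the only source of equal keys across the summands, so the keys
    order all points strictly. In this order the left side precedes the right one, and twistedness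
    makes the sum monotone on each. *)
Lemma exists_bitonic_osum :
    (forall x y q (p : 'S_q) a b,
      parametrizes d1 x p a -> parametrizes d2 y p b ->
      (forall i, side (inl (a i)) = side (inr (b i))) ->
      ~~ odd #|[pred i | side (inl (a i))]|) ->
  exists (J : {set 'I_(k + l)}) (hJ : #|J| = k) r,
    bitonic (osum hJ d1 d2) r /\ forall z, r (interleave hJ z) = side z.
Proof.
move=> no_pair; pose K := key f side o tie_break.
have K_cross x y : K (inl x) <> K (inr y).
  move=> [vxy txy].
  have [q [p [a [b [pa pb sab]]]]] := tie_break_cross vxy txy.
  by apply/negP; apply: no_pair pa pb sab.
have K_lt z z' : lt z z' -> (K z < K z')%O.
  move=> zz'; rewrite key_ltE; case: ltngtP (summand_lt_kneading zz') => //= vzz' _.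
  exact: tie_break_lt.
have K_inj : injective K.
  case=> x [] y // e; try by [case: (K_cross _ _ e)|case: (K_cross _ _ (esym e))].
    case: (ltngtP x y) => [xy|xy|/val_inj-> //].
      by have := K_lt (inl x) (inl y) xy; rewrite e ltxx.
    by have := K_lt (inl y) (inl x) xy; rewrite e ltxx.
  case: (ltngtP x y) => [xy|xy|/val_inj-> //].
    by have := K_lt (inr x) (inr y) xy; rewrite e ltxx.
  by have := K_lt (inr y) (inr x) xy; rewrite e ltxx.
have [J [hJ JE]] := exists_interleave K_inj
  (fun i j => K_lt (inl i) (inl j)) (fun i j => K_lt (inr i) (inr j)).
have [g intK gK] := interleave_bij hJ.
exists J, hJ, (side \o g); split => [x y|z]; last by rewrite /= intK.
rewrite -{1}(gK x) -{1}(gK y) JE => xy.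
rewrite -{2 4}(gK x) -{3 4}(gK y) !osum_interleave !JE /=.
move: (g x) (g y) xy => z z' {x y} zz'.
case sz: (side z); case sz': (side z').
- split => // _.
  have := key_lt_map sum_period_gt0 iter_sum_period twisted_tie_break _ zz'.
  by rewrite sz sz'; apply.
- have lt_v : v z' < v z by apply: (itinerary_lt_side f sum_period_gt0); rewrite ?sz ?sz'.
  by move: zz'; rewrite key_ltE; case: ltngtP lt_v.
- by split.
split => // _.
  have := key_lt_map sum_period_gt0 iter_sum_period twisted_tie_break _ zz'.
  by rewrite sz sz'; apply.
Qed.

End Existence.

(** * Sums with ordered peaks *)

Lemma parametrizes_porbit n (d : 'S_n) x y k (p : 'S_k) a :
  y \in porbit d x -> parametrizes d x p a -> parametrizes d y p a.
Proof. by rewrite -eq_porbit_mem /parametrizes => /eqP->. Qed.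

Lemma unimodal_peak n (d : 'S_n.+1) : unimodal d ->
  bitonic d (fun x => peak d < x) /\ bitonic d (fun x => peak d <= x).
Proof. by case/unimodal_bitonic=> m [lo hi /peak_uniq <-]. Qed.

Section Degrees.
Variables (n1 n2 : nat) (d1 : 'S_n1.+1) (d2 : 'S_n2.+1).

(* A unimodal sum has two monotone sides, its peak being on either; the order of
   the peaks says that they can be chosen so that the peak of [d1] is on the left
   and the peak of [d2] is on the right. *)
Definition sum_side (z : 'I_n1.+1 + 'I_n2.+1) : bool :=
  match z with inl x => peak d1 < x | inr y => peak d2 <= y end.

Section GivenSum.
Variables (J : {set 'I_(n1.+1 + n2.+1)}) (hJ : #|J| = n1.+1).
Local Notation s := (osum hJ d1 d2).

Lemma bitonic_inl r : bitonic s r -> bitonic d1 (r \o interleave hJ \o inl).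
Proof.
move=> sr; apply: (@bitonic_comp _ _ s d1 r (interleave hJ \o inl)) => //.
  exact: Omega_homo.
by move=> i /=; rewrite osum_Omega.
Qed.

Lemma bitonic_inr r : bitonic s r -> bitonic d2 (r \o interleave hJ \o inr).
Proof.
move=> sr; apply: (@bitonic_comp _ _ s d2 r (interleave hJ \o inr)) => //.
  exact: Omega_homo.
by move=> i /=; rewrite osum_Omega_compl.
Qed.

(** The peak of the sum is the peak of [d1] or of [d2]. Cut after it in the first case and before it
    in the second; the order of the peaks then puts the other one on the required side, and all
    other points have no choice. *)
Lemma osum_side : unimodal s -> peaks_ordered d1 d2 hJ ->
  exists r, bitonic s r /\ forall z, r (interleave hJ z) = sum_side z.
Proof.
move=> /unimodal_bitonic[M [lo hi sM]]; rewrite /peaks_ordered => m12.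
have [r [sr r1 r2]] : exists r, [/\ bitonic s r, r (interleave hJ (inl (peak d1))) = false
    & r (interleave hJ (inr (peak d2))) = true].
  have [g _ gK] := interleave_bij hJ.
  move: sM lo hi; rewrite -(gK M); case: (g M) => [x|y] sM lo hi.
    have xm : x = peak d1.
      apply: peak_uniq => y.
      have := sM (interleave hJ (inl y)).
      by rewrite !osum_interleave /= leqNgt ltn_Omega -leqNgt.
    by exists (fun z => interleave hJ (inl x) < z); split; rewrite // xm /= ?ltnn ?m12.
  have ym : y = peak d2.
    apply: peak_uniq => x.
    have := sM (interleave hJ (inr x)).
    by rewrite !osum_interleave /= leqNgt ltn_Omega -leqNgt.
  exists (fun z => interleave hJ (inr y) <= z); split; rewrite // ym /= ?leqnn //.
  by apply/negbTE; rewrite -ltnNge.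
exists r; split => // -[x|y] /=.
  have [->|xm] := eqVneq x (peak d1); first by rewrite r1 ltnn.
  exact: (bitonic_side (bitonic_inl sr) (@peakP _ d1) xm).
have [->|ym] := eqVneq y (peak d2); first by rewrite r2 leqnn.
rewrite leq_eqVlt (inj_eq val_inj) eq_sym (negbTE ym).
exact: (bitonic_side (bitonic_inr sr) (@peakP _ d2) ym).
Qed.

(** Once the two peaks are on the same side, so are all corresponding points of the two copies. The
    right part is then even, and [odd_card_side] turns this into the claim. *)
Lemma osum_common_shape r x1 x2 (u := interleave hJ) b :
    bitonic s r -> cycle_shape d1 x1 = cycle_shape d2 x2 ->
    r (u (inl (cycle_peak d1 x1))) = b -> r (u (inr (cycle_peak d2 x2))) = b ->
  acute (cycle_shape d1 x1) = ~~ b.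
Proof.
move=> sr e12.
have [a1 pa1] : exists a, parametrizes d1 x1 (tagged (cycle_shape d1 x1)) a.
  by exists (Omega erefl); apply: cycle_shape_parametrizes.
have [a2 pa2] : exists a, parametrizes d2 x2 (tagged (cycle_shape d1 x1)) a.
  by rewrite e12; exists (Omega erefl); apply: cycle_shape_parametrizes.
case: (cycle_shape d1 x1) a1 pa1 a2 pa2 => q p /= a1 pa1 a2 pa2 {e12}.
have [i0 pi0] := exists_max p (parametrizes_gt0 pa1).
rewrite (parametrizes_peak pa1 pi0) (parametrizes_peak pa2 pi0) => rb1 rb2.
have [a1_lt _ _ da1] := pa1; have [a2_lt _ _ da2] := pa2.
have pr1 := bitonic_comp (bitonic_inl sr) a1_lt da1.
have pr2 := bitonic_comp (bitonic_inr sr) a2_lt da2.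
have r12 i : r (u (inl (a1 i))) = r (u (inr (a2 i))).
  have [->|ii0] := eqVneq i i0; first by rewrite rb1.
  by have /= -> := bitonic_side pr1 pi0 ii0; have /= -> := bitonic_side pr2 pi0 ii0.
have := odd_card_side pr1 pi0; rewrite /= -/u rb1.
have /negbTE -> : ~~ odd #|[pred i | r (u (inl (a1 i)))]|.
  apply: (@no_conjugate_pair _ _ s r p (u \o inl \o a1) (u \o inr \o a2)) => //= i.
  - by rewrite osum_Omega da1.
  - by rewrite osum_Omega_compl da2.
  by apply/eqP => /(@interleave_inj _ _ J hJ (inl _) (inr _)).
by case: acute; case: b {rb1 rb2}.
Qed.

End GivenSum.

Lemma peaks_ordered_of_side (J : {set 'I_(n1.+1 + n2.+1)}) (hJ : #|J| = n1.+1) r :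
    bitonic (osum hJ d1 d2) r -> (forall z, r (interleave hJ z) = sum_side z) ->
  peaks_ordered d1 d2 hJ.
Proof.
move=> sr rE; have := rE (inr (peak d2)); have := rE (inl (peak d1)).
rewrite /peaks_ordered /= leqnn ltnn => r1 r2.
case: ltngtP => // [/sr[]|/val_inj e]; first by rewrite r1 r2 => /(_ isT).
by rewrite e r2 in r1.
Qed.

End Degrees.

Theorem theorem6 (n1 n2 : nat) (d1 : 'S_n1.+1) (d2 : 'S_n2.+1)
    (hd1 : unimodal d1) (hd2 : unimodal d2) :
  let hat1 := cycle_shape d1 (peak d1) in
  let hat2 := cycle_shape d2 (peak d2) in
  let cond1 := (exists s : anyperm, s \in A_gt d1 /\ s \in A_gt d2) \/
               (exists s : anyperm, s \in G_lt d1 /\ s \in G_lt d2) in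
  let cond2 := hat1 \in G_lt d2 \/ hat2 \in A_gt d1 in
  (cond1 ->
     ~ exists (J : {set 'I_(n1.+1 + n2.+1)}) (hJ : #|J| = n1.+1),
         unimodal (osum hJ d1 d2)) /\
  (~ cond1 -> cond2 ->
     ~ exists (J : {set 'I_(n1.+1 + n2.+1)}) (hJ : #|J| = n1.+1),
         unimodal (osum hJ d1 d2) /\ peaks_ordered d1 d2 hJ) /\
  (~ cond1 -> ~ cond2 ->
     exists! s : 'S_(n1.+1 + n2.+1),
       unimodal s /\
       exists (J : {set 'I_(n1.+1 + n2.+1)}) (hJ : #|J| = n1.+1),
         s = osum hJ d1 d2 /\ peaks_ordered d1 d2 hJ).
Proof.
have [bit1 _] := unimodal_peak hd1; have [_ bit2] := unimodal_peak hd2.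
split; [|split].
- move=> c [J [hJ /unimodal_bitonic us]].
  have [r sr] : exists r, bitonic (osum hJ d1 d2) r.
    by case: us => M [sr _ _]; exists (fun x => M < x).
  (* The cycles in this case have their peaks away from those of [d1] and [d2], so their sides are
     known without any order of [peak d1] and [peak d2]. *)
  have side1 (x : 'I_n1.+1) : x != peak d1 -> r (interleave hJ (inl x)) = (peak d1 < x).
    by move=> xm; have /= := bitonic_side (bitonic_inl sr) (@peakP _ d1) xm. 
  have side2 (x : 'I_n2.+1) : x != peak d2 -> r (interleave hJ (inr x)) = (peak d2 < x).
    by move=> xm; have /= := bitonic_side (bitonic_inr sr) (@peakP _ d2) xm.
  case: c => -[s [/andP[/andP[_ s1] /existsP[x1 /andP[/eqP e1 p1]]]]]
    /andP[_ /existsP[x2 /andP[/eqP e2 p2]]].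
    have := @osum_common_shape _ _ d1 d2 J hJ r x1 x2 true sr; rewrite -e1 -e2 s1.
    rewrite side1 ?side2 ?p1 ?p2; first by move=> /(_ erefl erefl erefl).
      by rewrite neq_ltn p2 orbT.
    by rewrite neq_ltn p1 orbT.
  have := @osum_common_shape _ _ d1 d2 J hJ r x1 x2 false sr; rewrite -e1 -e2.
  rewrite side1 ?side2 ?(leq_gtF (ltnW p1)) ?(leq_gtF (ltnW p2)).
  + by move=> /(_ erefl erefl erefl); apply/negP.
  + by rewrite neq_ltn p2.
  by rewrite neq_ltn p1.
- move=> _ c [J [hJ [us ord]]]; have [r [sr rE]] := osum_side us ord.
  case: c => /andP[/andP[_ hs] /existsP[x /andP[/eqP e px]]].
    have := @osum_common_shape _ _ d1 d2 J hJ r (peak d1) x false sr e.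
    rewrite !rE /= cycle_peak_peak ltnn leqNgt px => /(_ erefl erefl).
    exact/negP.
  have := @osum_common_shape _ _ d1 d2 J hJ r x (peak d2) true sr (esym e).
  by rewrite !rE /= cycle_peak_peak leqnn px -e hs => /(_ erefl erefl).
move=> nc1 nc2.
have [J [hJ [r [sr rE]]]] : exists (J : {set 'I_(n1.+1 + n2.+1)}) (hJ : #|J| = n1.+1) r,
    bitonic (osum hJ d1 d2) r /\ forall z, r (interleave hJ z) = sum_side d1 d2 z.
  apply: exists_bitonic_osum => // x y q p a b pa pb sab.
  have [i0 pi0] := exists_max p (parametrizes_gt0 pa).
  have [a_lt aJ _ da] := pa; have [_ bJ _ _] := pb.
  have := odd_card_side (bitonic_comp bit1 a_lt da) pi0.
  have ds := parametrizes_Delta_star bit1 pa.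
  have ea := parametrizes_cycle_shape pa; have eb := parametrizes_cycle_shape pb.
  have ka := parametrizes_peak pa pi0; have kb := parametrizes_peak pb pi0.
  have sab0 := sab i0; move=> /= ->; apply/negP => /eqP ac.
  rewrite /= -ac in sab0.
  (* An odd right part means that an acute shape has its peaks on the right, a grave one on the
     left. In the acute case the peak in [d1] lies strictly after [peak d1], while that in [d2] may
     be [peak d2] itself: equality contradicts [nc2], strict order [nc1]. The grave case is
     symmetric. *)
  case ac': (acute _) in ac sab0.
    have [e|ne] := eqVneq (b i0) (peak d2).
      apply: nc2; right.
      have := parametrizes_cycle_shape (parametrizes_porbit (bJ i0) pb).
      rewrite e => ->; apply/andP; split; first by rewrite ds ac'.
      by apply/existsP; exists x; rewrite ea eqxx ka -ac.
    apply: nc1; left; exists (Tagged (fun k => 'S_k) p);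
      split; (apply/andP; split; first by rewrite ds ac').
      by apply/existsP; exists x; rewrite ea eqxx ka -ac.
    by apply/existsP; exists y; rewrite eb eqxx kb ltn_neqAle -sab0 eq_sym ne.
  have pb0 : b i0 < peak d2 by rewrite ltnNge -sab0.
  have [e|ne] := eqVneq (a i0) (peak d1).
    apply: nc2; left; have := parametrizes_cycle_shape (parametrizes_porbit (aJ i0) pa).
    rewrite e => ->; apply/andP; split; first by rewrite ds /grave ac'.
    by apply/existsP; exists y; rewrite eb eqxx kb.
  apply: nc1; right; exists (Tagged (fun k => 'S_k) p);
    split; (apply/andP; split; first by rewrite ds /grave ac').
    apply/existsP; exists x; rewrite ea eqxx ka /= ltn_neqAle (inj_eq val_inj) ne.
    by rewrite leqNgt -ac.
  by apply/existsP; exists y; rewrite eb eqxx kb.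
exists (osum hJ d1 d2); split.
  split; first exact: bitonic_unimodal sr.
  by exists J, hJ; split => //; apply: peaks_ordered_of_side rE.
move=> s' [us' [J' [hJ' [es' ord']]]]; move: us'; rewrite {}es' => us'.
have [r' [sr' rE']] := osum_side us' ord'.
exact: (bitonic_conjugate_uniq (interleave_bij hJ) (interleave_bij hJ')
  (osum_interleave hJ d1 d2) (osum_interleave hJ' d1 d2) sr sr' rE rE').
Qed.
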